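(* Let $m\ge 1$ be an integer and, for $n\ge 0$, let $G_n=G_n(m)$ be the treelike fractal graph of generation $n$, with $N_n=(m+2)^n+1$ vertices. For $n\ge 1$, let $\lambda_1(n)\ge\lambda_2(n)\ge\cdots\ge\lambda_{N_n}(n)$ be the eigenvalues, listed with multiplicity, of the normalized Laplacian matrix of $G_n$. Then all the eigenvalues $\{\lambda_i(n)\}_{i=1}^{N_n}$, $n\ge 1$, are obtained by the following recursive relations: (i) $0$ and $2$ are both eigenvalues of multiplicity one for every $n\ge 1$. (ii) $1$ is an eigenvalue with multiplicity $m(m+2)^{n-1}+1$ for every $n\ge 1$. (iii) For every $n\ge 1$, the eigenvalues $\lambda(n+1)$ of generation $n+1$ other than $0$, $1$ and $2$ are, counted with multiplicity, exactly those produced via $$\lambda(n+1)=1\pm\sqrt{1-\frac{\lambda(n)}{m+2}}$$ from the eigenvalues $\lambda(n)$ of generation $n$ other than $0$ and $2$. That is, the multiset of eigenvalues of generation $n+1$ different from $0,1,2$ equals the multiset obtained by letting $\lambda(n)$ run, with multiplicity, over all eigenvalues of generation $n$ different from $0$ and $2$, and taking for each of them both values $1+\sqrt{1-\lambda(n)/(m+2)}$ and $1-\sqrt{1-\lambda(n)/(m+2)}$.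
   Context: For a finite simple undirected graph $G$ without isolated vertices, with adjacency matrix $A$ and diagonal degree matrix $D$, the normalized Laplacian matrix is $\mathcal{L}(G)=D^{-1/2}(D-A)D^{-1/2}$; its eigenvalues are the normalized Laplacian eigenvalues of $G$. Construction of $G_n(m)$ for integers $n\ge 0$, $m\ge 1$: $G_0(m)$ is a single edge joining two vertices. For $n\ge 1$, $G_n(m)$ is obtained from $G_{n-1}(m)$ by performing the following operation on every edge of $G_{n-1}(m)$: subdivide the edge $uv$ into two edges $uw$ and $wv$ by inserting a new vertex $w$ (so $uv$ is removed and replaced by a path of length 2 with middle vertex $w$), and then create $m$ further new vertices, each joined by an edge to the middle vertex $w$ only. Thus each edge is replaced by a star with center $w$ and $m+2$ leaves, two of which are $u$ and $v$. The graph $G_n(m)$ has $N_n=(m+2)^n+1$ vertices and $(m+2)^n$ edges. *)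

(* Defs.v *)
From mathcomp Require Import all_boot all_order all_algebra.
From mathcomp Require Import polyorder polyrcf complex spectral sesquilinear.

Set Implicit Arguments.
Unset Strict Implicit.
Unset Printing Implicit Defensive.

Import Order.TTheory GRing.Theory Num.Theory.
Local Open Scope ring_scope.

Record sgraph := SGraph {
  vertex :> finType;
  adj : rel vertex;
  adj_sym : symmetric adj;
  adj_irr : irreflexive adj }.

Definition edges (G : sgraph) : {set {set G}} :=
  [set [set p.1; p.2] | p : G * G & adj p.1 p.2].

Definition edge (G : sgraph) : finType := {e : {set G} | e \in edges G}.

(* Vertices of the graph obtained by replacing every edge of G by a star:
   [inl u] is an old vertex, [inr (e, None)] is the middle vertex of the edge
   e, and [inr (e, Some i)], with i < m, are the new leaves attached to it. *)
Definition star_vertex (m : nat) (G : sgraph) : finType :=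
  (G + edge G * option 'I_m)%type.

Definition star_adj (m : nat) (G : sgraph) : rel (star_vertex m G) :=
  fun x y => match x, y with
  | inl u, inr (e, None) | inr (e, None), inl u => u \in val e
  | inr (e, None), inr (e', Some _) | inr (e', Some _), inr (e, None) => e == e'
  | _, _ => false
  end.

Lemma star_adj_sym m G : symmetric (@star_adj m G).
Proof. by move=> [u|[e [i|]]] [v|[f [j|]]]. Qed.

Lemma star_adj_irr m G : irreflexive (@star_adj m G).
Proof. by move=> [u|[e [i|]]]. Qed.

Definition star_graph (m : nat) (G : sgraph) : sgraph :=
  SGraph (@star_adj_sym m G) (@star_adj_irr m G).

Lemma neq_sym (T : finType) : symmetric (fun x y : T => x != y).
Proof. by move=> x y; rewrite eq_sym. Qed.

Lemma neq_irr (T : finType) : irreflexive (fun x y : T => x != y).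
Proof. by move=> x; rewrite eqxx. Qed.

Definition K2 : sgraph := SGraph (@neq_sym bool) (@neq_irr bool).

Definition fractal (m n : nat) : sgraph := iter n (star_graph m) K2.

Lemma edge_pair (G : sgraph) (e : edge G) :
  exists u v, adj u v /\ val e = [set u; v].
Proof.
case: e => e /=; case/imsetP=> -[u v]; rewrite inE /= => uv ->.
by exists u, v.
Qed.

Lemma card_edge (G : sgraph) (e : edge G) : #|val e| = 2.
Proof.
have [u [v [uv ->]]] := edge_pair e; rewrite cards2.
by case: eqVneq uv => // ->; rewrite adj_irr.
Qed.

Lemma card_star_vertex m (G : sgraph) :
  #|star_graph m G| = (#|G| + #|edges G| * m.+1)%N.
Proof. by rewrite card_sum card_prod card_option card_ord card_sig. Qed.

Lemma card_star_edges m (G : sgraph) :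
  #|edges (star_graph m G)| = (m.+2 * #|edges G|)%N.
Proof.
pose X := [set p : edge G * star_graph m G | star_adj (inr (p.1, None)) p.2].
pose c (e : edge G) : star_graph m G := inr (e, None).
pose f (p : edge G * star_graph m G) := [set c p.1; p.2].
have -> : edges (star_graph m G) = f @: X.
  apply/setP => E; apply/imsetP/imsetP => -[].
    move=> [x y]; rewrite inE /= => xy ->.
    case: x y xy => [u|[e [i|]]] [v|[e' [j|]]] //= xy.
    - by exists (e', inl u); rewrite ?inE // /f setUC.
    - by exists (e', inr (e, Some i)); rewrite ?inE // /f setUC.
    - by exists (e, inl v); rewrite ?inE.
    - by exists (e, inr (e', Some j)); rewrite ?inE.
  move=> [e x]; rewrite inE => ex ->.
  by exists (c e, x); rewrite ?inE.
rewrite card_in_imset; last first.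
  move=> [e x] [e' x']; rewrite !inE /f /= => ex ex' /setP eqf.
  have ee' : e = e'.
    have := eqf (c e); rewrite !inE eqxx /= => /esym/orP[/eqP[]|/eqP cx] //.
    by move: ex'; rewrite -cx.
  move: ex' eqf; rewrite -ee' => ex' eqf; congr (_, _).
  have := eqf x; rewrite !inE eqxx orbT => /esym/orP[|] /eqP // xc.
  by move: ex; rewrite xc.
have -> : #|X| = (\sum_(e : edge G) #|[set x | star_adj (c e) x]|)%N.
  rewrite -sum1_card; under [RHS]eq_bigr do rewrite -sum1_card.
  by rewrite pair_big_dep; apply: eq_bigl => -[e x]; rewrite !inE.
rewrite (eq_bigr (fun => m.+2)); last first.
  move=> e _; pose S := [set (inl u : star_graph m G) | u in val e].
  pose L := [set (inr (e, Some i) : star_graph m G) | i : 'I_m].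
  have -> : [set x | star_adj (c e) x] = S :|: L.
    apply/setP => -[u|[e' [i|]]]; rewrite !inE /=.
    - rewrite mem_imset; last by move=> ? ? [].
      by case: imsetP => [[]//|_]; rewrite orbF.
    - case: imsetP => [[]//|_] /=; case: eqVneq => [<-|ne].
        by rewrite imset_f.
      by case: imsetP => // -[j _ [ee']]; rewrite ee' eqxx in ne.
    - by case: imsetP => [[]//|_]; case: imsetP => [[]//|_].
  have SL0 : S :&: L = set0.
    apply/setP => x; rewrite !inE; apply/andP => -[/imsetP[u _ ->]].
    by case/imsetP.
  rewrite cardsU SL0 cards0 subn0 card_imset; last by move=> ? ? [].
  by rewrite card_edge card_imset ?card_ord ?add2n // => ? ? [].
by rewrite sum_nat_const card_sig mulnC.
Qed.

Lemma card_fractal_edges m n : #|edges (fractal m n)| = (m.+2 ^ n)%N.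
Proof.
elim: n => [|n IH]; last by rewrite expnS -IH /fractal iterS card_star_edges.
have -> : edges K2 = [set [set true; false]].
  apply/setP => E; rewrite inE; apply/imsetP/eqP => [[[x y]]|->].
    by rewrite inE /=; case: x y => -[] // _ -> //; rewrite setUC.
  by exists (true, false); rewrite ?inE.
by rewrite cards1.
Qed.

Lemma card_fractal m n : #|fractal m n| = (m.+2 ^ n).+1.
Proof.
elim: n => [|n IH]; first by rewrite card_bool.
rewrite /fractal iterS card_star_vertex -/(fractal m n) IH card_fractal_edges.
by rewrite addSn -mulnS mulnC -expnS.
Qed.

Section Matrices.
Variables (R : rcfType) (G : sgraph).

Definition degree (x : G) : nat := #|[set y | adj x y]|.

Definition adjmx : 'M[R]_#|G| :=
  \matrix_(i, j) (adj (enum_val i) (enum_val j))%:R.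

Definition degmx : 'M[R]_#|G| :=
  diag_mx (\row_i (degree (enum_val i))%:R).

Definition degmx_invsqrt : 'M[R]_#|G| :=
  diag_mx (\row_i (Num.sqrt (degree (enum_val i))%:R)^-1).

Definition norm_laplacian : 'M[R]_#|G| :=
  degmx_invsqrt *m (degmx - adjmx) *m degmx_invsqrt.

Lemma norm_laplacian_sym : norm_laplacian^T = norm_laplacian.
Proof.
rewrite /norm_laplacian !trmx_mul linearB /= !tr_diag_mx mulmxA.
congr (_ *m (_ - _) *m _); apply/matrixP => i j.
by rewrite !mxE adj_sym.
Qed.

End Matrices.

(* The eigenvalues of A lying in R, in nonincreasing order and repeated
   according to their algebraic multiplicity; by [spectrum_prod] these are all
   the eigenvalues when A is symmetric. *)
Definition spectrum (R : rcfType) (n : nat) (A : 'M[R]_n) : seq R :=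
  sort >=%R (flatten [seq nseq (\mu_x (char_poly A)) x
                         | x <- rootsR (char_poly A)]).

Lemma char_poly_conj (F : fieldType) n (P D : 'M[F]_n) : P \in unitmx ->
  char_poly (invmx P *m D *m P) = char_poly D.
Proof.
move=> uP; rewrite /char_poly.
have uQ : map_mx polyC P \in unitmx by rewrite map_unitmx.
have -> : char_poly_mx (invmx P *m D *m P)
    = invmx (map_mx polyC P) *m char_poly_mx D *m map_mx polyC P.
  rewrite /char_poly_mx mulmxBr mulmxBl !map_mxM /= map_invmx.
  by rewrite [in RHS]scalar_mxC mulmxKV.
by rewrite !det_mulmx mulrC mulrA -det_mulmx mulmxV // det1 mul1r.
Qed.

Lemma char_poly_sym_split (R : rcfType) n (A : 'M[R]_n) : A^T = A ->
  exists s : seq R, char_poly A = \prod_(a <- s) ('X - a%:P).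
Proof.
move=> symA; pose c := @real_complex R; pose B := map_mx c A.
have hB : B \is hermsymmx.
  apply: realsym_hermsym.
    by apply/is_hermitianmxP; rewrite expr0 scale1r map_mx_id // map_trmx symA.
  by apply/mxOverP => i j; rewrite mxE complex_real.
have /orthomx_spectralP eB := hermitian_normalmx hB.
have /mxOverP rD := hermitian_spectral_diag_real hB.
pose s := [seq complex.Re (spectral_diag B 0 i) | i <- enum 'I_n].
exists s; apply: (map_poly_inj c).
rewrite map_char_poly -/B eB char_poly_conj ?spectral_unit //.
rewrite char_poly_trig ?diag_mx_is_trig // big_map enumT rmorph_prod /=.
apply: eq_bigr => i _; rewrite rmorphB /= map_polyX map_polyC /= mxE eqxx mulr1n.
congr (_ - _%:P); exact/esym/complex.RRe_real/rD.
Qed.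

Lemma count_mem_spectrum (R : rcfType) n (A : 'M[R]_n) (x : R) :
  count_mem x (spectrum A) = \mu_x (char_poly A).
Proof.
have p0 : char_poly A != 0 by rewrite monic_neq0 ?char_poly_monic.
rewrite (permP (permEl (perm_sort _ _))) count_flatten -map_comp sumnE big_map.
rewrite (eq_bigr (fun j => if j == x then \mu_x (char_poly A) else 0)%N); last first.
  by move=> j _; rewrite /= count_nseq /=; case: eqVneq => [->|_]; rewrite ?mul1n.
rewrite -big_mkcond /= big_const_seq.
have rx : (x \in rootsR (char_poly A)) = root (char_poly A) x.
  by rewrite -roots_on_rootsR // in_itv.
have u : uniq (rootsR (char_poly A)).
  by apply: (sorted_uniq lt_trans ltxx); apply: sorted_roots.
have := count_uniq_mem x u; rewrite rx => ->.
case: (boolP (root _ _)) => [_|/muNroot -> //]; exact: addn0.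
Qed.

Lemma spectrum_prod (R : rcfType) n (A : 'M[R]_n) : A^T = A ->
  char_poly A = \prod_(a <- spectrum A) ('X - a%:P).
Proof.
move=> /char_poly_sym_split[s pE]; rewrite pE; apply: perm_big.
rewrite perm_sym; apply/allP => x _ /=; rewrite count_mem_spectrum pE.
elim: s {pE} => [|a s IH] /=; first by rewrite big_nil mu_polyC.
rewrite big_cons mu_mul; last first.
  by rewrite monic_neq0 // monicMl ?monicXsubC // monic_prod_XsubC.
rewrite -(eqP IH) eqn_add2r; case: (eqVneq a x) => [->|ax]; first by rewrite mu_XsubC.
by rewrite muNroot // root_XsubC eq_sym.
Qed.

(* Main.v *)
Require Import Defs.
From mathcomp Require Import all_boot all_order all_algebra.
From mathcomp Require Import ring lra.

Set Implicit Arguments.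
Unset Strict Implicit.
Unset Printing Implicit Defensive.

Import Order.TTheory GRing.Theory Num.Theory.
Local Open Scope ring_scope.

(** Write [L = 1 - P] with [P] the normalized adjacency matrix.  Let [H] be
obtained from a tree [G] with [E] edges by replacing each edge by a star, and
let [L_G], [L_H] be their normalized Laplacians.  The idea is to eliminate all
vertices of [H] except the centers, and then to pass from edges of [G] back to
vertices of [G].

[H] is bipartite, with the centers on one side, so the determinant of [a - P_H]
is, up to a power of [a], that of [a^2 - W W^T], where [W] is the block of
[P_H] with a row for each center ([det_scalar_sub_bipartite]).  A center has
degree [m + 2] and the old vertices keep their degree, whence
[(m + 2) W W^T = C^T C + m], where [C] is the degree-normalized vertex-edge
incidence matrix of [G] ([spokemx_mul_tr]).  On the other hand
[C C^T = 1 + P_G = 2 - L_G] ([ninc_mul_tr]), and [C^T C] and [C C^T] have the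
same characteristic polynomial up to a power of the indeterminate
([det_scalar_sub_mulC]), a single one because [G] has [E + 1] vertices.
Altogether ([char_poly_star]), up to a nonzero constant,
[(2 - q) * char_poly L_H = ('X - 1)^(m E + 1) * (char_poly L_G \Po q)],
[q = (m + 2) (1 - ('X - 1)^2)].

The equation [q(z) = x] has the two roots [1 +- sqrt (1 - x / (m + 2))], and
the factor [2 - q] on the left cancels the contribution of the simple
eigenvalue [2] of [L_G].  So the spectrum of [L_H] consists of [1], with
multiplicity [m E + 1], and of the two roots attached to every eigenvalue of
[L_G] other than [2] ([spectrum_star]).  Starting from the spectrum [0, 2] of a
single edge, induction shows that all eigenvalues stay in [[0, 2]] and that [0]
and [2] stay simple: the roots attached to [0] are [0] and [2], and for
[0 < x <= 2] both roots avoid [0], [1] and [2], since [0 < x < m + 2]. *)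

(** * Determinants of products and of bipartite matrices *)

(** Sylvester's identity.  Let [M] be the block matrix [[a, A; B, 1]].  Clearing
[B] gives [\det M = \det (a%:M - A *m B)]; clearing [A], after the second block
of columns has been scaled by [a], gives
[\det M * a ^+ p = a ^+ n * \det (a%:M - B *m A)]. *)
Lemma det_scalar_sub_mulC (K : comNzRingType) (n p : nat) (a : K)
    (A : 'M[K]_(n, p)) (B : 'M[K]_(p, n)) :
  \det (a%:M - A *m B) * a ^+ p = a ^+ n * \det (a%:M - B *m A).
Proof.
pose M := block_mx a%:M A B 1%:M.
have detM : \det M = \det (a%:M - A *m B).
  have := congr1 determinant
    (mulmx_block a%:M A B 1%:M 1%:M 0 (- B) 1%:M : M *m _ = _).
  rewrite det_mulmx det_lblock !det1 !mulr1 => ->.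
  by rewrite !mulmx1 !mulmx0 mul1mx mulmxN subrr !add0r det_ublock det1 mulr1.
rewrite -detM; have := congr1 determinant
    (mulmx_block a%:M A B 1%:M 1%:M (- A) 0 a%:M : M *m _ = _).
rewrite det_mulmx det_ublock det1 mul1r det_scalar => ->.
rewrite !mulmx1 !mulmx0 mul1mx mulmxN mul_scalar_mx mul_mx_scalar addNr !addr0.
by rewrite det_lblock det_scalar mulmxN [_ + a%:M]addrC.
Qed.

(** Here [J] includes one side of the bipartition into the whole index set and
[W] holds the rows of that side, so that [J *m W + W^T *m J^T] is a symmetric
matrix without entries inside either side.  Multiplying [a - S] by [a + J W],
whose determinant is [a ^+ n], removes the block [J W], after which two uses
of Sylvester's identity apply. *)
Lemma det_scalar_sub_bipartite (K : idomainType) (n p : nat) (a : K)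
    (J : 'M[K]_(n, p)) (W : 'M[K]_(p, n)) :
  a != 0 -> J^T *m J = 1%:M -> W *m J = 0 ->
  \det (a%:M - (J *m W + W^T *m J^T)) * a ^+ (2 * p)
    = a ^+ n * \det ((a ^+ 2)%:M - W *m W^T).
Proof.
move=> a0 JJ WJ; have JW : J^T *m W^T = 0 by rewrite -trmx_mul WJ trmx0.
have detJW : \det (a%:M + J *m W) = a ^+ n.
  apply: (mulIf (expf_neq0 p a0)); have := det_scalar_sub_mulC a J (- W).
  by rewrite mulmxN mulNmx WJ oppr0 subr0 opprK det_scalar.
have fact : (a%:M - (J *m W + W^T *m J^T)) *m (a%:M + J *m W)
    = (a ^+ 2)%:M - W^T *m (a *: J^T + W).
  rewrite mulmxDr !mulmxBl !mulmxDl -!mulmxA (mulmxA W) WJ mul0mx mulmx0 add0r.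
  rewrite (mulmxA J^T) JJ mul1mx mulmxDr -scalar_mxM -expr2.
  rewrite !mul_mx_scalar !mul_scalar_mx -scalemxAr.
  by rewrite [a *: (J *m W) + _]addrC !opprD !addrA subrK.
have := det_scalar_sub_mulC (a ^+ 2) W^T (a *: J^T + W).
rewrite -fact det_mulmx detJW mulmxDl -scalemxAl JW scaler0 add0r => E.
apply: (mulIf (expf_neq0 n a0)).
rewrite mulrAC exprM E -exprM mulnC exprM expr2; ring.
Qed.

(** * Matrices indexed by finite types *)

Section FinMatrix.
Variable K : pzRingType.
Implicit Types T U V : finType.

Definition finmx T U (f : T -> U -> K) : 'M[K]_(#|T|, #|U|) :=
  \matrix_(i, j) f (enum_val i) (enum_val j).

Lemma eq_finmx T U (f g : T -> U -> K) : f =2 g -> finmx f = finmx g.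
Proof. by move=> fg; apply/matrixP => i j; rewrite !mxE fg. Qed.

Lemma tr_finmx T U (f : T -> U -> K) : (finmx f)^T = finmx (fun y x => f x y).
Proof. by apply/matrixP => i j; rewrite !mxE. Qed.

Lemma mul_finmx T U V (f : T -> U -> K) (g : U -> V -> K) :
  finmx f *m finmx g = finmx (fun x z => \sum_y f x y * g y z).
Proof.
apply/matrixP => i j; rewrite !mxE.
rewrite [RHS](reindex _ (onW_bij _ (@enum_val_bij U))) /=.
by apply: eq_bigr => k _; rewrite !mxE.
Qed.

Lemma scalar_finmx T (a : K) : a%:M = finmx (fun x y : T => a *+ (x == y)).
Proof.
by apply/matrixP => i j; rewrite !mxE (inj_eq enum_val_inj).
Qed.

Lemma add_finmx T U (f g : T -> U -> K) :
  finmx f + finmx g = finmx (fun x y => f x y + g x y).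
Proof. by apply/matrixP => i j; rewrite !mxE. Qed.

Lemma scale_finmx T U a (f : T -> U -> K) :
  a *: finmx f = finmx (fun x y => a * f x y).
Proof. by apply/matrixP => i j; rewrite !mxE. Qed.

End FinMatrix.

(** * Edges at a vertex *)

Lemma big_option (K : Type) (idx : K) (op : Monoid.com_law idx) (T : finType)
    (F : option T -> K) :
  \big[op/idx]_o F o = op (F None) (\big[op/idx]_x F (Some x)).
Proof.
rewrite (bigD1 None) //=; congr (op _ _).
rewrite (reindex_omap Some id) //=; last by case.
by apply: eq_bigl => x; rewrite eqxx.
Qed.

(** Without loops, [y |-> [set u; y]] is injective on the neighbours of [u]; it
reaches every edge at [u]. *)
Lemma sum_edges_at (G : sgraph) (u : G) (F : {set G} -> nat) :
  (\sum_(e : edge G | u \in val e) F (val e)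
     = \sum_(y | adj u y) F [set u; y])%N.
Proof.
rewrite -(big_sub_cond (mem (edges G)) (fun E => u \in E)) /=.
have inj : {in [set y | adj u y] &, injective (fun y => [set u; y])}.
  move=> y z; rewrite !inE => uy uz /setP/(_ y); rewrite !inE eqxx orbT.
  by case/esym/orP => /eqP // yu; rewrite yu adj_irr in uy.
transitivity (\sum_(y in [set y | adj u y]) F [set u; y])%N; last first.
  by apply: eq_bigl => y; rewrite inE.
rewrite -(big_imset _ inj) /=; apply: eq_bigl => E; apply/andP/imsetP.
  case=> /imsetP[[x y]]; rewrite inE /= => xy ->; rewrite !inE.
  case/orP=> /eqP ->; first by exists y; rewrite ?inE.
  by exists x; rewrite ?inE 1?adj_sym // setUC.
case=> y; rewrite inE => uy ->; rewrite !inE eqxx; split=> //.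
by apply/imsetP; exists (u, y); rewrite ?inE.
Qed.

Lemma degreeE (G : sgraph) (u : G) : degree u = (\sum_(y | adj u y) 1)%N.
Proof. by rewrite /degree -sum1_card; apply: eq_bigl => y; rewrite inE. Qed.

Lemma card_edges_at (G : sgraph) (u : G) :
  #|[set e : edge G | u \in val e]| = degree u.
Proof.
rewrite -sum1_card (eq_bigl (fun e : edge G => u \in val e)).
  by rewrite (sum_edges_at u (fun=> 1%N)) degreeE.
by move=> e; rewrite inE.
Qed.

Lemma sum_common_edges (G : sgraph) (u v : G) :
  (\sum_(e : edge G) (u \in val e) * (v \in val e)
     = (u == v) * degree u + adj u v)%N.
Proof.
transitivity (\sum_(e : edge G | u \in val e) (v \in val e))%N.
  by rewrite [RHS]big_mkcond; apply: eq_bigr => e _; case: (u \in val e);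
    rewrite ?mul1n ?mul0n.
rewrite (sum_edges_at u (fun E => v \in E : nat)).
case: eqVneq => [<-|uv].
  rewrite adj_irr addn0 mul1n (eq_bigr (fun=> 1%N)); last first.
    by move=> y _; rewrite !inE eqxx.
  by rewrite degreeE.
rewrite mul0n add0n; under eq_bigr do rewrite !inE eq_sym (negPf uv) /=.
have [a|na] := boolP (adj u v); last first.
  by rewrite big1 // => y uy; case: eqVneq => // vy; rewrite vy uy in na.
rewrite (bigD1 v) //= eqxx big1 ?addn0 // => y /andP[_].
by rewrite eq_sym => /negPf ->.
Qed.

(** * Normalized adjacency and incidence matrices *)

Section NormalizedAdjacency.
Variables (R : rcfType) (G : sgraph).

Definition nadj (x y : G) : R :=
  (adj x y)%:R / (Num.sqrt (degree x)%:R * Num.sqrt (degree y)%:R).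

Definition ninc (x : G) (e : edge G) : R :=
  (x \in val e)%:R / Num.sqrt (degree x)%:R.

Lemma nadj_sym x y : nadj x y = nadj y x.
Proof. by rewrite /nadj adj_sym mulrC [_ * Num.sqrt _]mulrC mulrC. Qed.

Hypothesis deg_gt0 : forall x : G, (0 < degree x)%N.

Lemma sqrt_degree_neq0 (x : G) : Num.sqrt (degree x)%:R != 0 :> R.
Proof. by rewrite gt_eqF // sqrtr_gt0 ltr0n. Qed.

Lemma sqr_sqrt_degree (x : G) :
  Num.sqrt (degree x)%:R * Num.sqrt (degree x)%:R = (degree x)%:R :> R.
Proof. by rewrite -expr2 sqr_sqrtr // ler0n. Qed.

Lemma norm_laplacianE : norm_laplacian R G = 1%:M - finmx nadj.
Proof.
apply/matrixP => i j; rewrite /norm_laplacian !mul_diag_mx !mul_mx_diag !mxE.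
have := sqrt_degree_neq0 (enum_val i); have := sqrt_degree_neq0 (enum_val j).
rewrite /nadj; case: (eqVneq i j) => [<-|_].
  rewrite adj_irr !mulr1n; have := sqr_sqrt_degree (enum_val i).
  by move: (Num.sqrt _) => s <- s0 _; rewrite /=; field.
by rewrite /= mulr0n => s0 t0; field; rewrite s0 t0.
Qed.

(** The signless Laplacian [D + A] is the product of the incidence matrix with
its transpose; this is its degree-normalized form, equal to
[2 - norm_laplacian R G]. *)
Lemma ninc_mul_tr :
  finmx ninc *m (finmx ninc)^T = 1%:M + finmx nadj.
Proof.
rewrite tr_finmx mul_finmx scalar_finmx add_finmx; apply: eq_finmx => u v.
have su := sqrt_degree_neq0 u; have sv := sqrt_degree_neq0 v.
transitivity ((\sum_(e : edge G) (u \in val e) * (v \in val e))%:R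
    / (Num.sqrt (degree u)%:R * Num.sqrt (degree v)%:R) : R).
  rewrite natr_sum mulr_suml; apply: eq_bigr => e _; rewrite natrM /ninc.
  by field; rewrite su sv.
rewrite sum_common_edges natrD natrM mulrDl; congr (_ + _).
case: eqVneq => [<-|_]; last by rewrite !mul0r.
by rewrite mul1r sqr_sqrt_degree divff // pnatr_eq0 -lt0n.
Qed.

End NormalizedAdjacency.

(** * The star graph *)

Section StarGraph.
Variables (R : rcfType) (m : nat) (G : sgraph).
Hypothesis deg_gt0 : forall x : G, (0 < degree x)%N.
Let H := star_graph m G.

Definition center (e : edge G) : H := inr (e, None).

(** Each edge at an old vertex [u] is replaced by the edge from [u] to the
center of that edge. *)
Lemma degree_old (u : G) : @degree H (inl u) = degree u.
Proof.
have inj : injective center by move=> e f [].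
rewrite -(card_edges_at u) -(card_imset _ inj) /degree; apply: eq_card.
move=> [v|[e [i|]]]; rewrite !inE /=.
- by apply/esym/negbTE/imsetP => -[].
- by apply/esym/negbTE/imsetP => -[].
- by rewrite (mem_imset _ _ inj) inE.
Qed.

Lemma degree_leaf (e : edge G) (i : 'I_m) : @degree H (inr (e, Some i)) = 1%N.
Proof.
rewrite /degree -(cards1 (center e)); apply: eq_card => -[v|[f [j|]]];
  rewrite !inE //=; first by apply/esym/eqP.
by apply/eqP/eqP => [->|[]].
Qed.

Lemma degree_center (e : edge G) : degree (center e) = m.+2.
Proof.
rewrite degreeE big_sumType /= sum1_card card_edge.
rewrite big_mkcond.
rewrite (eq_bigr (fun p : edge G * option 'I_m => (e == p.1) * p.2)%N);
  last first.
  by move=> [f [i|]] _ /=; case: (e == f).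
rewrite -(pair_bigA _ (fun f (o : option 'I_m) => (e == f) * o)%N) /=.
under eq_bigr do rewrite big_option /= muln0 sum_nat_const card_ord muln1.
rewrite (bigD1 e) //= eqxx big1 ?addn0 ?muln1 // => f /negPf.
by rewrite eq_sym => ->; rewrite muln0.
Qed.

Lemma degree_star_gt0 (x : H) : (0 < degree x)%N.
Proof.
case: x => [u|[e [i|]]].
- by rewrite degree_old.
- by rewrite degree_leaf.
- by rewrite degree_center.
Qed.

Lemma sum_center (K : pzSemiRingType) (x : H) (F : edge G -> K) :
  \sum_e (x == center e)%:R * F e = if x is inr (e, None) then F e else 0.
Proof.
case: x => [u|[e [i|]]];
  try by rewrite big1 // => f _; case: eqP => // _; rewrite mul0r.
rewrite (bigD1 e) //= eqxx mul1r big1 ?addr0 // => f fe.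
by case: eqP => [[ef]|_]; rewrite ?mul0r //; rewrite ef eqxx in fe.
Qed.

Definition centermx : 'M[R]_(#|H|, #|edge G|) :=
  finmx (fun x e => (x == center e)%:R).
Definition spokemx : 'M[R]_(#|edge G|, #|H|) :=
  finmx (fun e y => nadj R (center e) y).

Lemma centermxK : centermx^T *m centermx = 1%:M.
Proof.
rewrite tr_finmx mul_finmx scalar_finmx; apply: eq_finmx => e f.
rewrite (bigD1 (center e)) //= eqxx mul1r big1 ?addr0.
  by congr (_ *+ nat_of_bool _); apply/eqP/eqP => [[]|->].
by move=> x /negPf ->; rewrite mul0r.
Qed.

Lemma spoke_centermx : spokemx *m centermx = 0.
Proof.
rewrite mul_finmx; apply/matrixP => i j; rewrite !mxE big1 // => x _.
by case: eqP => [->|_]; rewrite ?mulr0 // /nadj /= mul0r mul0r.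
Qed.

(** Every edge of the star graph has exactly one end that is a center. *)
Lemma nadj_star :
  finmx (@nadj R H) = centermx *m spokemx + spokemx^T *m centermx^T.
Proof.
rewrite !tr_finmx !mul_finmx add_finmx; apply: eq_finmx => x y.
under [in X in _ + X]eq_bigr do rewrite mulrC.
rewrite !sum_center.
case: x => [u|[e [i|]]]; case: y => [v|[f [j|]]];
  rewrite ?addr0 ?add0r //; try by rewrite /nadj /= mul0r.
- exact: nadj_sym.
- exact: nadj_sym.
- by rewrite /nadj /= !mul0r addr0.
Qed.

(** Walks of length two between centers: through an old vertex they give the
entries of [C^T C], with [C] the normalized incidence matrix of [G]; through a
leaf they return to the center they came from, which [m] leaves allow. *)
Lemma spokemx_mul_tr :
  m.+2%:R *: (spokemx *m spokemx^T)
    = (finmx (@ninc R G))^T *m finmx (@ninc R G) + m%:R%:M.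
Proof.
rewrite !tr_finmx !mul_finmx scale_finmx scalar_finmx add_finmx.
apply: eq_finmx => e f; rewrite big_sumType /= mulrDr; congr (_ + _).
  rewrite mulr_sumr; apply: eq_bigr => u _.
  rewrite /nadj /ninc /= degree_old !degree_center.
  have s0 := sqrt_degree_neq0 R deg_gt0 u.
  have t2 : Num.sqrt m.+2%:R ^+ 2 = m.+2%:R :> R by rewrite sqr_sqrtr // ler0n.
  have t0 : Num.sqrt m.+2%:R != 0 :> R by rewrite gt_eqF // sqrtr_gt0 ltr0n.
  move: (Num.sqrt m.+2%:R) t2 t0 => t <- t0.
  by field; rewrite s0 t0.
have t2 : Num.sqrt m.+2%:R ^+ 2 = m.+2%:R :> R by rewrite sqr_sqrtr // ler0n.
have t0 : Num.sqrt m.+2%:R != 0 :> R by rewrite gt_eqF // sqrtr_gt0 ltr0n.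
transitivity (\sum_(g : edge G) (e == g)%:R * ((f == g)%:R * m%:R) : R).
  pose F g o := nadj R (center e) (inr (g, o)) * nadj R (center f) (inr (g, o)).
  rewrite (eq_bigr (fun p => F p.1 p.2)); last by case.
  rewrite -(pair_bigA _ F) mulr_sumr /F.
  apply: eq_bigr => g _; rewrite big_option.
  rewrite {1}/nadj /= !mul0r add0r -[m in RHS]card_ord -sum1_card natr_sum.
  rewrite !mulr_sumr; apply: eq_bigr => i _.
  rewrite /nadj !degree_center degree_leaf sqrtr1 /=.
  by move: (Num.sqrt m.+2%:R) t2 t0 => t <- t0; field.
rewrite (bigD1 e) //= eqxx mul1r big1 ?addr0.
  by rewrite eq_sym mulrC mulr_natr.
by move=> g /negPf; rewrite eq_sym => ->; rewrite mul0r.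
Qed.

End StarGraph.

(** * Decimation of the characteristic polynomial *)

Section StarCharPoly.
Variables (R : rcfType) (m : nat).

Lemma det_comp_char_poly n (A : 'M[R]_n) (q : {poly R}) :
  \det (q%:M - map_mx polyC A) = char_poly A \Po q.
Proof.
rewrite /char_poly -[RHS](det_map_mx (comp_poly q)) /=; congr (\det _).
by apply/matrixP => i j; rewrite !mxE comp_polyB comp_polyC rmorphMn /=
  comp_polyX.
Qed.

Definition renorm : {poly R} := m.+2%:R *: (1 - ('X - 1) ^+ 2).

Lemma two_sub_renorm_neq0 : 2%:P - renorm != 0.
Proof.
apply/eqP => /(congr1 (horner^~ 0)); rewrite /renorm !hornerE /=.
by move/eqP; rewrite sqrrN expr1n subrr mulr0 subr0 pnatr_eq0.
Qed.

Variable G : sgraph.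
Hypothesis deg_gt0 : forall x : G, (0 < degree x)%N.
Hypothesis card_tree : #|G| = #|edges G|.+1.

(** The elimination is carried out with [a = 'X - 1], as ['X - L_H] is
[a + P_H], and then with [y = (m + 2) a ^+ 2 - m], which is [2 - renorm].  The
factor [2 - renorm] on the left comes from the surplus of one vertex over the
number of edges; the constant [c] collects a sign and a power of [m + 2]. *)
Lemma char_poly_star : exists2 c : R, c != 0 &
  (2%:P - renorm) * char_poly (norm_laplacian R (star_graph m G))
    = c *: (('X - 1) ^+ (m * #|edges G| + 1)
              * (char_poly (norm_laplacian R G) \Po renorm)).
Proof.
pose E := #|edge G|; have cE : #|edges G| = E by rewrite /E card_sig.
pose a : {poly R} := 'X - 1; pose k : R := m.+2%:R.
have a0 : a != 0 by rewrite /a -polyC1 polyXsubC_eq0.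
have k0 : k != 0 by rewrite pnatr_eq0.
(* The sign of [W] turns [a - (J W + W^T J^T)] into [a + P_H]. *)
pose J := map_mx polyC (centermx R m G).
pose W := - map_mx polyC (spokemx R m G).
pose C := map_mx polyC (finmx (@ninc R G)).
pose pH := char_poly (norm_laplacian R (star_graph m G)).
pose D := \det ((a ^+ 2)%:M - W *m W^T).
have pHE : pH = a ^+ (m * E + 1) * D.
  apply: (mulIf (expf_neq0 (2 * E) a0)).
  have JJ : J^T *m J = 1%:M by rewrite map_trmx -map_mxM centermxK map_mx1.
  have WJ : W *m J = 0 by rewrite mulNmx -map_mxM spoke_centermx map_mx0 oppr0.
  have cH : #|star_graph m G| = (m * E + 1 + 2 * E)%N.
    by rewrite card_star_vertex card_tree cE; ring.
  rewrite mulrAC -exprD -cH -(det_scalar_sub_bipartite a0 JJ WJ).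
  congr (\det _ * _); rewrite /char_poly_mx norm_laplacianE; last first.
    exact: degree_star_gt0.
  rewrite nadj_star map_mxB map_mx1 map_mxD !map_mxM -!map_trmx -/J.
  have -> : a%:M = 'X%:M - 1%:M :> 'M_#|star_graph m G| by rewrite -raddfB.
  rewrite /W mulmxN linearN /= mulNmx -opprD opprK.
  by rewrite [- (1%:M - _)]opprD opprK addrA.
pose y : {poly R} := 2%:P - renorm.
have y0 : y != 0 := two_sub_renorm_neq0.
have yE : y = k%:P * a ^+ 2 - m%:R%:P.
  have kE : k%:P = m%:R%:P + 2%:P by rewrite -polyCD -natrD addn2.
  by rewrite /y /renorm -/a -mul_polyC -/k kE; ring.
have DE : k%:P ^+ E * D = \det (y%:M - C^T *m C).
  rewrite -detZ; congr (\det _).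
  rewrite scalerBr scale_scalar_mx yE raddfB /= -addrA -opprD; congr (_ - _).
  rewrite /W /C linearN /= mulmxN mulNmx opprK !map_trmx -!map_mxM.
  rewrite -map_scalar_mx -map_mxD addrC -spokemx_mul_tr //.
  by rewrite map_mxZ.
have Dy : \det (y%:M - C^T *m C) * y = \det (y%:M - C *m C^T).
  apply: (mulIf (expf_neq0 E y0)); rewrite -mulrA -exprS -cE -card_tree.
  by rewrite det_scalar_sub_mulC mulrC cE.
have DG : \det (y%:M - C *m C^T)
    = (-1) ^+ #|G| * (char_poly (norm_laplacian R G) \Po renorm).
  rewrite -det_comp_char_poly -detZ; congr (\det _).
  rewrite /C map_trmx -map_mxM ninc_mul_tr // norm_laplacianE // /y.
  apply/matrixP => i j; rewrite !mxE.
  rewrite polyCD polyCB; case: eqVneq => _ /=; rewrite ?mulr1n ?mulr0n.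
    by rewrite polyC1; ring.
  by rewrite polyC0; ring.
exists (k ^- E * (-1) ^+ #|G|).
  by rewrite mulf_neq0 ?invr_eq0 ?expf_neq0 // oppr_eq0 oner_eq0.
rewrite -/y -/pH -/a cE.
have arrange (u v w z : {poly R}) : u * (v * (w * z)) = w * (u * z * v) by ring.
have main : k%:P ^+ E * (y * pH) = a ^+ (m * E + 1)
    * ((-1) ^+ #|G| * (char_poly (norm_laplacian R G) \Po renorm)).
  by rewrite pHE arrange DE Dy DG.
rewrite -[LHS]scale1r -[X in X *: _ = _](mulVf (expf_neq0 E k0)) -!scalerA.
congr (_ *: _).
rewrite -[LHS]mul_polyC polyC_exp main [RHS]scalerAr; congr (_ * _).
by rewrite -mul_polyC rmorphXn rmorphN1.
Qed.

End StarCharPoly.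

(** * Decimation of the spectrum *)

Section Spectrum.
Variables (R : rcfType) (m : nat).

(** The two solutions [z] of [(renorm R m).[z] = x], for [x <= m + 2]. *)
Definition renorm_roots (x : R) : seq R :=
  [:: 1 + Num.sqrt (1 - x / (m + 2)%:R); 1 - Num.sqrt (1 - x / (m + 2)%:R)].

Lemma renorm_sub_factor (x : R) : x <= (m + 2)%:R ->
  renorm R m - x%:P = - (m + 2)%:R *: \prod_(z <- renorm_roots x) ('X - z%:P).
Proof.
move=> lex; rewrite /renorm -[m.+2]addn2.
have k0 : (0 : R) < (m + 2)%:R by rewrite ltr0n addn2.
rewrite !big_cons big_nil mulr1; move: (m + 2)%:R lex k0 => k lex k0.
have : Num.sqrt (1 - x / k) ^+ 2 = 1 - x / k.
  by rewrite sqr_sqrtr // subr_ge0 ler_pdivrMr // mul1r.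
move: (Num.sqrt _) => s s2.
have {s2 lex} -> : x = k - k * s ^+ 2.
  by rewrite s2; field; rewrite gt_eqF.
by rewrite -!mul_polyC polyCN !polyCD !polyCN polyCM polyC_exp polyC1; ring.
Qed.

Lemma filter_eq1 (T : eqType) (s : seq T) (x : T) :
  count_mem x s = 1%N -> [seq y <- s | y == x] = [:: x].
Proof.
move=> s1; have /all_pred1P -> := filter_all (pred1 x) s.
by rewrite size_filter s1.
Qed.

(** The factor [2 - renorm] of [char_poly_star] cancels against the factor
[renorm - 2] that the simple eigenvalue [2] of [G] contributes; both remaining
sides are products of linear factors, so their roots agree as multisets. *)
Lemma spectrum_star (G : sgraph) :
  (forall x : G, (0 < degree x)%N) -> #|G| = #|edges G|.+1 ->
  let s := spectrum (norm_laplacian R G) in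
  {in s, forall x, x <= (m + 2)%:R} -> count_mem 2 s = 1%N ->
  perm_eq (spectrum (norm_laplacian R (star_graph m G)))
    (nseq (m * #|edges G| + 1) 1
       ++ flatten [seq renorm_roots x | x <- s & x != 2]).
Proof.
move=> deg_gt0 card_tree s les s2; apply: prod_XsubC_eq.
rewrite -spectrum_prod ?norm_laplacian_sym //; set t := _ ++ _.
have [c c0] := char_poly_star R m deg_gt0 card_tree.
set q := renorm R m; set y := 2%:P - q.
have y0 : y != 0 := two_sub_renorm_neq0 R m.
have -> : char_poly (norm_laplacian R G) \Po q
    = - y * \prod_(x <- s | x != 2) (q - x%:P).
  rewrite (spectrum_prod (norm_laplacian_sym _ _)) rmorph_prod /=.
  under eq_bigr do rewrite comp_polyB comp_polyX comp_polyC.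
  rewrite (bigID (pred1 2)) /= -big_filter filter_eq1 // big_seq1.
  by rewrite /y opprB.
have [d d0 ->] : exists2 d : R, d != 0 & \prod_(x <- s | x != 2) (q - x%:P)
    = d *: \prod_(z <- flatten [seq renorm_roots x | x <- s & x != 2])
             ('X - z%:P).
  rewrite big_flatten big_map big_filter {t s2}; elim: s les => [|x s IH] les.
    by exists 1; rewrite ?oner_eq0 // !big_nil scale1r.
  have [|d d0 E] := IH; first by move=> z zs; apply: les; rewrite inE zs orbT.
  rewrite 2!big_cons; case: ifP => _; last by exists d.
  exists (- (m + 2)%:R * d); first by rewrite mulf_neq0 // oppr_eq0
    pnatr_eq0 addn2.
  rewrite E renorm_sub_factor ?les ?mem_head //.
  by rewrite -scalerAl -scalerAr scalerA.
have prod1 : \prod_(z <- nseq (m * #|edges G| + 1) 1) ('X - z%:P)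
    = ('X - 1) ^+ (m * #|edges G| + 1) :> {poly R}.
  by rewrite big_nseq polyC1 iter_mulr_1.
have arrange (u v w A B : {poly R}) :
  u * - (v * (A * (w * B))) = v * (- u * w * (A * B)) by ring.
rewrite mulrCA mulNr => E.
have {}E : char_poly (norm_laplacian R (star_graph m G))
    = (- c * d) *: \prod_(z <- t) ('X - z%:P).
  apply: (mulfI y0); rewrite E /t big_cat /= prod1.
  by rewrite -!mul_polyC polyCM polyCN arrange.
(* Both polynomials are monic, so the constant between them is [1]. *)
have := congr1 lead_coef E; rewrite lead_coefZ.
rewrite (monicP (char_poly_monic _)) (monicP (monic_prod_XsubC _ _ _)) mulr1.
by move=> cd; rewrite E -cd scale1r.
Qed.

(** With [0 < m], an eigenvalue in [[0, 2]] is smaller than [m + 2], so the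
square root below is nonzero and [1] is never one of the two roots. *)
Hypothesis m_gt0 : (0 < m)%N.

Lemma renorm_rootsE (x : R) : 0 <= x <= 2 ->
  exists2 r : R, 0 < r <= 1 /\ (r == 1) = (x == 0)
    & renorm_roots x = [:: 1 + r; 1 - r].
Proof.
move=> /andP[x0 x2]; have k2 : (2 : R) < (m + 2)%:R by rewrite ltr_nat addn2.
have k0 : (0 : R) < (m + 2)%:R by apply: lt_trans k2.
exists (Num.sqrt (1 - x / (m + 2)%:R)) => //.
have u0 : 0 < 1 - x / (m + 2)%:R.
  by rewrite subr_gt0 ltr_pdivrMr // mul1r (le_lt_trans x2).
have u1 : 1 - x / (m + 2)%:R <= 1 by rewrite gerBl divr_ge0 // ltW.
split; first by rewrite sqrtr_gt0 u0 -[X in _ <= X]sqrtr1 ler_wsqrtr.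
rewrite -[X in _ == X]sqrtr1 eqr_sqrt ?ltW //.
by rewrite -subr_eq0 addrAC subrr add0r oppr_eq0 mulf_eq0 invr_eq0
  (gt_eqF k0) orbF.
Qed.

Lemma renorm_roots_in02 (x y : R) :
  0 <= x <= 2 -> y \in renorm_roots x -> 0 <= y <= 2.
Proof.
move=> x02; have [r [/andP[r0 r1] _] ->] := renorm_rootsE x02.
by rewrite !inE => /orP[] /eqP ->; lra.
Qed.

Lemma count_renorm_roots (x : R) : 0 <= x <= 2 ->
  [/\ count_mem 0 (renorm_roots x) = (x == 0),
      count_mem 1 (renorm_roots x) = 0%N
    & count_mem 2 (renorm_roots x) = (x == 0)].
Proof.
move=> x02; have [r [/andP[r0 r1] <-] ->] := renorm_rootsE x02; split => /=.
- have -> : (1 + r == 0) = false by lra.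
  by rewrite add0n addn0 subr_eq0 eq_sym.
- have -> : (1 + r == 1) = false by lra.
  by have -> : (1 - r == 1) = false by lra.
- have -> : (1 - r == 2) = false by lra.
  by rewrite !addn0; congr nat_of_bool; lra.
Qed.

Lemma filter_renorm_roots (x : R) : 0 <= x <= 2 ->
  [seq y <- renorm_roots x | [&& y != 0, y != 1 & y != 2]]
    = if x != 0 then renorm_roots x else [::].
Proof.
move=> x02; have [r [/andP[r0 r1] <-] ->] := renorm_rootsE x02.
case: eqVneq => [->|rn1] /=.
  have -> : (1 + 1 == 2 :> R) = true by lra.
  by rewrite subrr eqxx !andbF.
have {rn1} r1 : r < 1 by rewrite lt_neqAle rn1.
have -> : (1 + r == 0) = false by lra.
have -> : (1 + r == 1) = false by lra.
have -> : (1 + r == 2) = false by lra.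
have -> : (1 - r == 0) = false by lra.
have -> : (1 - r == 1) = false by lra.
by have -> : (1 - r == 2) = false by lra.
Qed.

Lemma count_flatten_map (T : Type) (U : eqType) (f : U -> seq T) (P : pred T)
    (Q : pred U) (s : seq U) :
  {in s, forall x, count P (f x) = Q x} ->
  count P (flatten (map f s)) = count Q s.
Proof.
elim: s => //= x s IH PQ; rewrite count_cat PQ ?mem_head ?IH // => y ys.
by rewrite PQ // inE ys orbT.
Qed.

Lemma filter_flatten_map (T : Type) (U : eqType) (f : U -> seq T) (P : pred T)
    (Q : pred U) (s : seq U) :
  {in s, forall x, filter P (f x) = if Q x then f x else [::]} ->
  filter P (flatten (map f s)) = flatten (map f (filter Q s)).
Proof.
elim: s => //= x s IH PQ; rewrite filter_cat PQ ?mem_head //.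
rewrite IH; first by case: (Q x).
by move=> y ys; rewrite PQ // inE ys orbT.
Qed.

End Spectrum.

(** * The fractal graphs *)

(** The normalized Laplacian of an edge is [2 - u u^T], where [u] is the
all-ones column, so Sylvester's identity reduces its characteristic polynomial
to a determinant of size one. *)
Lemma spectrum_K2 (R : rcfType) :
  perm_eq (spectrum (norm_laplacian R K2)) [:: 0; 2].
Proof.
have degree1 (x : K2) : degree x = 1%N.
  by rewrite degreeE big_mkcond big_bool; case: x.
pose u : 'M[{poly R}]_(#|K2|, 1) := const_mx 1.
pose a : {poly R} := 'X - 2%:P; have a0 : a != 0 by rewrite polyXsubC_eq0.
apply: prod_XsubC_eq; rewrite -spectrum_prod ?norm_laplacian_sym //.
have -> : char_poly (norm_laplacian R K2) = \det (a%:M - (- u) *m u^T).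
  rewrite /char_poly; congr (\det _); rewrite norm_laplacianE; last first.
    by move=> x; rewrite degree1.
  apply/matrixP => i j; rewrite !mxE big_ord1 !mxE /nadj !degree1 /= sqrtr1.
  rewrite -(inj_eq enum_val_inj) /a.
  case: eqVneq => _ /=; rewrite ?mulr1n ?mulr0n polyCB polyCM ?polyC1 ?polyC0.
    by rewrite !mulr1 invr1 polyC1; ring.
  by rewrite !mulr1 invr1 polyC1; ring.
apply: (mulIf a0); rewrite -[X in _ * X]expr1 det_scalar_sub_mulC.
rewrite (_ : a ^+ #|K2| = a ^+ 2); last by rewrite card_bool.
have -> : a%:M - u^T *m - u = (a + 2%:P)%:M.
  apply/matrixP => i j; rewrite !mxE !ord1 eqxx !mulr1n.
  under eq_bigr do rewrite !mxE.
  by rewrite sumr_const card_ord card_bool mul1r mulNrn opprK polyC_natr.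
by rewrite det_scalar1 !big_cons big_nil /a polyC0; ring.
Qed.

Lemma degree_fractal_gt0 m n (x : fractal m n) : (0 < degree x)%N.
Proof.
elim: n x => [|n IH] x; last exact: degree_star_gt0.
by rewrite degreeE big_mkcond big_bool; case: x.
Qed.

Theorem theorem4 (R : rcfType) (m : nat) (m_ge1 : (1 <= m)%N) :
  let lambda (n : nat) : seq R := spectrum (norm_laplacian R (fractal m n)) in
  (forall n : nat, (1 <= n)%N ->
     count_mem 0 (lambda n) = 1%N /\ count_mem 2 (lambda n) = 1%N) /\
  (forall n : nat, (1 <= n)%N ->
     count_mem 1 (lambda n) = (m * (m + 2) ^ (n - 1) + 1)%N) /\
  (forall n : nat, (1 <= n)%N ->
     perm_eq [seq x <- lambda n.+1 | [&& x != 0, x != 1 & x != 2]]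
       (flatten [seq [:: 1 + Num.sqrt (1 - x / (m + 2)%:R);
                         1 - Num.sqrt (1 - x / (m + 2)%:R)]
                    | x <- lambda n & (x != 0) && (x != 2)])).
Proof.
move=> lambda.
pose next n := nseq (m * (m + 2) ^ n + 1) (1 : R)
  ++ flatten [seq renorm_roots m x | x <- lambda n & x != 2].
have step n : {in lambda n, forall x, 0 <= x <= 2} ->
    count_mem 2 (lambda n) = 1%N ->
    perm_eq (lambda n.+1) (next n).
  move=> s02 s2; rewrite /next addn2 -card_fractal_edges.
  apply: spectrum_star => //.
  - exact: degree_fractal_gt0.
  - by rewrite card_fractal card_fractal_edges.
  - by move=> x /s02/andP[_ x2]; rewrite (le_trans x2) // ler_nat addn2.
have inv n : [/\ {in lambda n, forall x, 0 <= x <= 2},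
    count_mem 0 (lambda n) = 1%N & count_mem 2 (lambda n) = 1%N].
  elim: n => [|n [s02 s0 s2]].
    split; first 1 last.
    - by rewrite (permP (spectrum_K2 R)) /= eqxx pnatr_eq0.
    - by rewrite (permP (spectrum_K2 R)) /= eq_sym pnatr_eq0 eqxx.
    - by move=> x; rewrite (perm_mem (spectrum_K2 R)) !inE => /orP[]/eqP->; lra.
  have st := step n s02 s2.
  have f02 : {in [seq x <- lambda n | x != 2], forall x, 0 <= x <= 2}.
    by move=> x; rewrite mem_filter => /andP[_ /s02].
  have one (y : R) : (1 == y) = false ->
      (forall x, 0 <= x <= 2 -> count_mem y (renorm_roots m x) = (x == 0)) ->
      count_mem y (lambda n.+1) = 1%N.
    move=> y1 cy; rewrite (permP st) count_cat count_nseq /= y1 mul0n add0n.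
    rewrite (count_flatten_map (Q := pred1 0)); last by move=> x /f02/cy.
    rewrite count_filter -[RHS]s0; apply: eq_count => x /=.
    by case: eqVneq => // ->; rewrite eq_sym pnatr_eq0.
  split.
  - move=> x; rewrite (perm_mem st) mem_cat mem_nseq => /orP[/andP[_ /eqP->]|].
      by lra.
    by case/flatten_mapP => z zs; apply: renorm_roots_in02 => //; apply: f02.
  - by apply: one => [|x x02];
      [rewrite oner_eq0 | have [] := count_renorm_roots m_ge1 x02].
  - apply: one; last by move=> x x02; have [] := count_renorm_roots m_ge1 x02.
    by rewrite (eqr_nat _ 1 2).
split; first by move=> n _; have [] := inv n.
split=> [[//|n] _|n _]; have [s02 s0 s2] := inv n; have st := step n s02 s2.
- rewrite (permP st) count_cat count_nseq /= eqxx mul1n subn1 /=.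
  rewrite (count_flatten_map (Q := pred0)) ?count_pred0 ?addn0 // => x.
  by rewrite mem_filter => /andP[_ /s02]/(count_renorm_roots m_ge1)[].
- apply: (perm_trans (perm_filter _ st)).
  rewrite filter_cat filter_nseq eqxx andbF /=.
  rewrite (filter_flatten_map (Q := fun x => x != 0)); last first.
    by move=> x; rewrite mem_filter => /andP[_ /s02]/(filter_renorm_roots m_ge1).
  by rewrite -filter_predI.
Qed.
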